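(* Let $X$ be a real Banach space with dual $X^*$. (a) An element $x\in S_X$ is a uniformly $\ell_1^2$ point if and only if the diameter of the weak$^*$-slice $S(x;\epsilon)=\{x^*\in B_{X^*}: x^*(x)>1-\epsilon\}$ is two for every $\epsilon>0$. (b) An element $x^*\in S_{X^*}$ is a uniformly $\ell_1^2$ point (of $X^*$) if and only if the slice $S(x^*;\epsilon)=\{x\in B_X: x^*(x)>1-\epsilon\}$ satisfies $\operatorname{diam}S(x^*;\epsilon)=2$ for every $\epsilon>0$.
   Context: $S_Y$ and $B_Y$ denote the unit sphere and the closed unit ball of a Banach space $Y$. A point $x\in S_Y$ is a uniformly $\ell_1^2$ point (of $Y$) if for every $\delta>0$ there is $y\in S_Y$ such that $\min\{\|x+y\|,\|x-y\|\}>2-\delta$. *)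

(* Defs.v *)
From HB Require Import structures.
From mathcomp Require Import all_boot all_order all_algebra.
From mathcomp Require Import all_classical all_reals all_analysis.

Set Implicit Arguments.
Unset Strict Implicit.
Unset Printing Implicit Defensive.

Import Order.TTheory GRing.Theory Num.Theory.
Import numFieldNormedType.Exports.

Local Open Scope classical_set_scope.
Local Open Scope ring_scope.

Section unit_sphere_ball.
Context {R : realType}.

Definition unit_sphere (Y : normedModType R) : set Y := [set y | `|y| = 1].

Definition unit_ball (Y : normedModType R) : set Y := [set y | `|y| <= 1].

(* Taken in the extended reals, so that it is meaningful for every set;
   the diameter of the empty set is -oo. *)
Definition diam (Y : normedModType R) (A : set Y) : \bar R :=
  ereal_sup [set d | exists y z, [/\ A y, A z & d = `|y - z|%:E]].

End unit_sphere_ball.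
Arguments unit_sphere {R} Y.
Arguments unit_ball {R} Y.

Section dual.
Context {R : realType} (X : normedModType R).

Definition dual_pred : {pred X -> R^o} :=
  [pred f : X -> R^o | `[< scalar f /\ continuous f >]].

Record dual := Dual { dual_fun :> X -> R^o; _ : dual_fun \in dual_pred }.

HB.instance Definition _ := [isSub for dual_fun].
HB.instance Definition _ := [Choice of dual by <:].

Lemma dual_scalar (f : dual) : scalar f.
Proof. by case: f => f /= /asboolP[]. Qed.

Lemma dual_continuous (f : dual) : continuous f.
Proof. by case: f => f /= /asboolP[]. Qed.

HB.instance Definition _ (f : dual) :=
  GRing.isLinear.Build R X R^o *:%R f (@dual_scalar f).

Lemma dual_submod_closed : submod_closed dual_pred.
Proof.
split=> [|a f g /asboolP[lf cf] /asboolP[lg cg]]; apply/asboolP; split.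
- by move=> a x y; rewrite /= mulr0 addr0.
- by move=> x; exact: cvg_cst.
- move=> b x y; rewrite !fctE lf lg /GRing.scale /=.
  by rewrite !mulrDr !addrA mulrCA; congr (_ + _); rewrite addrAC.
- by move=> x; apply: cvgD; [apply: cvgZr; exact: cf | exact: cg].
Qed.

HB.instance Definition _ :=
  GRing.isSubmodClosed.Build _ _ dual_pred dual_submod_closed.
HB.instance Definition _ := [SubChoice_isSubLmodule of dual by <:].

Definition dual_norm (f : dual) : R := sup [set `|f x| | x in unit_ball X].

Lemma dual_has_sup (f : dual) : has_sup [set `|f x| | x in unit_ball X].
Proof.
split; first by exists `|f 0|, 0 => //; rewrite /unit_ball /= normr0.
have /linear_bounded_continuous/bounded_funP/(_ 1)[M fM] := @dual_continuous f.
by exists M => _ [x /= x1 <-]; exact: fM.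
Qed.

Lemma dual_norm_ub (f : dual) (x : X) : unit_ball X x -> `|f x| <= dual_norm f.
Proof.
by move=> x1; apply: sup_ubound; [exact: (dual_has_sup f).2 | exists x].
Qed.

Lemma dual_norm_le (f : dual) (M : R) :
  (forall x, unit_ball X x -> `|f x| <= M) -> dual_norm f <= M.
Proof.
move=> fM; apply: ge_sup; first exact: (dual_has_sup f).1.
by move=> _ [x x1 <-]; exact: fM.
Qed.

Lemma dual_norm_ge0 (f : dual) : 0 <= dual_norm f.
Proof.
by apply: le_trans (@dual_norm_ub f 0 _); rewrite // /unit_ball /= normr0.
Qed.

Lemma dual_norm_bound (f : dual) (x : X) : `|f x| <= dual_norm f * `|x|.
Proof.
have [->|x0] := eqVneq x 0; first by rewrite linear0 !normr0 mulr0.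
rewrite -ler_pdivrMr ?normr_gt0// mulrC.
have := @dual_norm_ub f (`|x|^-1 *: x); rewrite linearZ /unit_ball /= !normrZ.
by rewrite normfV normr_id; apply; rewrite mulVf ?normr_eq0.
Qed.

Lemma dual_normD (f g : dual) :
  dual_norm (f + g) <= dual_norm f + dual_norm g.
Proof.
apply: dual_norm_le => x x1; apply: le_trans (ler_normD _ _) _.
by apply: lerD; exact: dual_norm_ub.
Qed.

Lemma dual_normZ (a : R) (f : dual) : dual_norm (a *: f) = `|a| * dual_norm f.
Proof.
have leZ b (h : dual) : dual_norm (b *: h) <= `|b| * dual_norm h.
  apply: dual_norm_le => x x1.
  by rewrite [leLHS]normrM ler_wpM2l//; exact: dual_norm_ub.
apply/eqP; rewrite eq_le leZ /=.
have [->|a0] := eqVneq a 0; first by rewrite normr0 mul0r dual_norm_ge0.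
rewrite -ler_pdivlMl ?normr_gt0// -normfV.
by rewrite -{1}[f](scalerK a0) leZ.
Qed.

Lemma dual_norm_eq0 (f : dual) : dual_norm f = 0 -> f = 0.
Proof.
move=> f0; apply/val_inj/funext => x /=.
by apply/eqP; rewrite -normr_le0 (le_trans (dual_norm_bound f x))// f0 mul0r.
Qed.

HB.instance Definition _ :=
  Lmodule_isNormed.Build R dual dual_normD dual_normZ dual_norm_eq0.

Lemma dual_ball (f g : dual) (e : R) :
  ball f e g -> forall x, `|f x - g x| <= e * `|x|.
Proof.
rewrite -ball_normE /= => fge x; apply: le_trans (dual_norm_bound (f - g) x) _.
by rewrite ler_wpM2r//; exact: ltW.
Qed.

Lemma dual_cauchy_cvg (F : set_system dual) :
  ProperFilter F -> cauchy F -> cvg F.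
Proof.
move=> FF /cauchyP Fc.
pose ev x (f : dual) : R^o := f x.
have Fx x : cvg (ev x @ F).
  apply: (@cauchy_cvg R); apply/cauchy_exP => e e0.
  have d0 : 0 < e / (`|x| + 1) by rewrite divr_gt0// ltr_wpDl.
  have [f0 Ff0] := Fc _ d0; exists (f0 x).
  suff: F [set f | ball (f0 x) e (f x)] by [].
  apply: filterS Ff0 => f /dual_ball /(_ x) f0f.
  apply: (le_lt_trans f0f); rewrite mulrAC ltr_pdivrMr ?ltr_wpDl//.
  by rewrite ltr_pM2l// ltrDl.
pose g x : R^o := lim (ev x @ F).
have gE (f0 : dual) e x : F (ball f0 e) -> `|f0 x - g x| <= e * `|x|.
  move=> Ff0; apply/ler_addgt0Pr => d d0.
  have /cvgrPdist_lt /(_ _ d0) Fg := Fx x.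
  near F => f.
  rewrite -(subrKA (f x)) (le_trans (ler_normD _ _))// lerD//.
    by apply: dual_ball; near: f.
  by rewrite distrC ltW//; near: f.
have gs : scalar g.
  move=> a x y; apply: cvg_lim => //.
  apply: (cvg_trans (G := (fun f : dual => a * ev x f + ev y f) @ F)); last first.
    by apply: cvgD; [apply: cvgMr; exact: Fx|exact: Fx].
  by apply: near_eq_cvg; apply: nearW => f; rewrite /ev dual_scalar.
pose gl : {linear X -> R^o} :=
  HB.pack g (GRing.isLinear.Build R X R^o *:%R g gs).
have gc : continuous g.
  apply: (@bounded_linear_continuous _ _ _ gl); apply/bounded_funP => r.
  have [f1 Ff1] := Fc _ ltr01; exists ((dual_norm f1 + 1) * r) => x xr.
  have f1g := gE _ _ x Ff1.
  rewrite /= -[g x](subKr (f1 x)) (le_trans (ler_normB _ _))//.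
  apply: (@le_trans _ _ ((dual_norm f1 + 1) * `|x|)).
    by rewrite mulrDl lerD// dual_norm_bound.
  by rewrite ler_wpM2l// addr_ge0// dual_norm_ge0.
have gP : g \in dual_pred by apply/asboolP.
apply/cvg_ex; exists (Dual gP); apply/cvgrPdist_le => /= e e0.
have e20 : 0 < e / 2 by rewrite divr_gt0.
have [f0 Ff0] := Fc _ e20.
apply: filterS (Ff0) => f f0f; apply: dual_norm_le => x x1 /=.
rewrite -[X in `|X|]/(g x - f x) -(subrKA (f0 x)) [e]splitr.
rewrite (le_trans (ler_normD _ _))// lerD//.
  by rewrite distrC (le_trans (gE _ _ _ Ff0))// ler_piMr// ltW.
by rewrite (le_trans (dual_ball f0f x))// ler_piMr// ltW.
Unshelve. all: by end_near. Qed.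

HB.instance Definition _ := Uniform_isComplete.Build dual dual_cauchy_cvg.

End dual.

Section slices.
Context {R : realType}.

Definition uniformly_l12_point (Y : completeNormedModType R) (x : Y) : Prop :=
  unit_sphere Y x /\
  forall delta : R, 0 < delta ->
    exists2 y : Y, unit_sphere Y y & 2 - delta < Num.min `|x + y| `|x - y|.

Definition wstar_slice (X : completeNormedModType R) (x : X) (eps : R) :
    set (dual X) :=
  [set f | unit_ball (dual X) f /\ 1 - eps < f x].

Definition slice (X : completeNormedModType R) (f : dual X) (eps : R) : set X :=
  [set x | unit_ball X x /\ 1 - eps < f x].

End slices.

(* Main.v *)
(** A functional f in the dual ball with f (x + y) > 2 - d satisfies both
    f x > 1 - d and f y > 1 - d. Hence a point y witnessing the l_1^2 property
    at x yields, by norming x + y and x - y, two functionals of the slice at x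
    that are almost 2 apart at y; conversely, a point y of the ball at which two
    functionals of the slice almost differ by 2 is a witness at x. The same
    argument with the roles of X and its dual exchanged gives (b).

    Norming functionals come from the Hahn-Banach theorem, obtained without
    extending partial functionals: below any sublinear functional there is a
    minimal one by Zorn's lemma, and minimal sublinear functionals are linear. *)
Require Import Defs.
From HB Require Import structures.
From mathcomp Require Import all_boot all_order all_algebra.
From mathcomp Require Import all_classical all_reals all_analysis.
From mathcomp Require Import lra.

Set Implicit Arguments.
Unset Strict Implicit.
Unset Printing Implicit Defensive.

Import Order.TTheory GRing.Theory Num.Theory.
Import numFieldNormedType.Exports.

Local Open Scope classical_set_scope.
Local Open Scope ring_scope.

(** * The Hahn-Banach theorem through minimal sublinear functionals *)

Lemma le_infD (R : realType) (A B : set R) (c : R) :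
  A !=set0 -> B !=set0 -> (forall a b, A a -> B b -> c <= a + b) ->
  c <= inf A + inf B.
Proof.
move=> A0 B0 cAB; rewrite -lerBlDr; apply: lb_le_inf => // a Aa.
rewrite lerBlDr -lerBlDl; apply: lb_le_inf => // b Bb.
by rewrite lerBlDl cAB.
Qed.

Section hahn_banach.
Context {R : realType} {V : lmodType R}.
Implicit Types (p q : V -> R) (x y z : V).

(* Positive homogeneity is recovered from the inequality applied to t and
   to t^-1. *)
Definition sublinear q :=
  (forall x y, q (x + y) <= q x + q y) /\
  (forall t x, 0 < t -> q (t *: x) <= t * q x).

Lemma sublinear0 q : sublinear q -> q 0 = 0.
Proof.
move=> [qD qZ]; have := qD 0 0; have := qZ 2^-1 0.
by rewrite addr0 scaler0 invr_gt0 ltr0n => /(_ isT); lra.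
Qed.

Lemma sublinearZ q t x : sublinear q -> 0 <= t -> q (t *: x) = t * q x.
Proof.
move=> sq; rewrite le_eqVlt => /predU1P[<-|t0].
  by rewrite scale0r mul0r sublinear0.
apply/eqP; rewrite eq_le sq.2//= -ler_pdivlMl//.
by rewrite -{1}(scalerK (lt0r_neq0 t0) x) sq.2 ?invr_gt0.
Qed.

Lemma sublinear_ge q x : sublinear q -> - q (- x) <= q x.
Proof.
move=> sq; rewrite lerNl -subr_ge0 opprK -(sublinear0 sq) -(addNr x).
exact: sq.1.
Qed.

Definition translates q z x : set R :=
  [set q (x + t *: z) - t * q z | t in [set t | 0 <= t]].

(** For sublinear [q], this is the greatest sublinear functional below [q] whose value at [- z] is
    [- q z]. *)
Definition sublinear_shift q z x : R := inf (translates q z x).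

Lemma translates_neq0 q z x : translates q z x !=set0.
Proof. by exists (q (x + 0 *: z) - 0 * q z), 0 => /=. Qed.

Lemma sublinear_shift_le q z x t : sublinear q -> 0 <= t ->
  sublinear_shift q z x <= q (x + t *: z) - t * q z.
Proof.
move=> sq t0; apply: ge_inf; last by exists t.
(* The infimum is finite: [s *: z] is the sum of [x + s *: z] and [- x], so subadditivity bounds
   every translate below by [- q (- x)]. *)
exists (- q (- x)) => _ [s /= s0 <-]; rewrite -(sublinearZ z sq s0).
by have := sq.1 (x + s *: z) (- x); rewrite addrAC subrr add0r; lra.
Qed.

Lemma sublinear_shift_sublinear q z :
  sublinear q -> sublinear (sublinear_shift q z).
Proof.
move=> sq; split=> [x y|t x t0].
  apply: le_infD; [exact: translates_neq0..|].
  move=> _ _ [s /= s0 <-] [t /= t0 <-].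
  apply: le_trans (sublinear_shift_le z (x + y) sq (addr_ge0 s0 t0)) _.
  have := sq.1 (x + s *: z) (y + t *: z).
  by rewrite addrACA -scalerDl mulrDl; lra.
rewrite -ler_pdivrMl//; apply: lb_le_inf; first exact: translates_neq0.
move=> _ [s /= s0 <-]; rewrite ler_pdivrMl//.
apply: le_trans (sublinear_shift_le z _ sq (mulr_ge0 (ltW t0) s0)) _.
by rewrite -scalerA -scalerDr (sublinearZ _ sq (ltW t0)) mulrBr mulrA.
Qed.

Lemma sublinear_shift_id q z x : sublinear q -> sublinear_shift q z x <= q x.
Proof.
move=> sq; have := sublinear_shift_le z x sq (lexx 0).
by rewrite scale0r addr0 mul0r subr0.
Qed.

Lemma sublinear_minorant_exists p : sublinear p ->
  exists q, [/\ sublinear q, (forall x, q x <= p x) &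
    forall r, sublinear r -> (forall x, r x <= q x) -> forall x, r x = q x].
Proof.
move=> sp.
pose P q := sublinear q /\ forall x, q x <= p x.
pose T := {q | P q}.
(* The order is reversed, so that a maximal element for Zorn's lemma is a minimal functional. *)
pose le (a b : T) : bool := `[< forall x, sval b x <= sval a x >].
have lePP a b : reflect (forall x, sval b x <= sval a x) (le a b).
  exact: asboolP.
have [|r s t /lePP rs /lePP st||A Atot|[q [sq qp]] qmin] := @Zorn T le.
- by move=> t; apply/lePP.
- by apply/lePP => x; exact: le_trans (st x) (rs x).
- move=> [q hq] [r hr] /lePP /= qr /lePP /= rq; apply: eq_exist.
  by apply/funext => x; apply/eqP; rewrite eq_le rq qr.
- have [[a0 Aa0]|A0] := pselect (A !=set0); last first.
    exists (exist P p (conj sp (fun x => lexx (p x)))) => s As.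
    by case: A0; exists s.
  pose vals x : set R := [set sval a x | a in A].
  have vals0 x : vals x !=set0 by exists (sval a0 x), a0.
  have inf_le a x : A a -> inf (vals x) <= sval a x.
    move=> Aa; apply: ge_inf; last by exists a.
    (* This lower bound does not depend on [b]: [- p (- x) <= - b (- x) <= b x]. *)
    exists (- p (- x)) => _ [[b [sb bp]] /= Ab <-].
    by apply: le_trans (sublinear_ge x sb); rewrite lerN2.
  suff sm : sublinear (fun x => inf (vals x)).
    have mp x : inf (vals x) <= p x.
      exact: le_trans (inf_le a0 x Aa0) ((svalP a0).2 x).
    exists (exist P _ (conj sm mp)) => a Aa; apply/lePP => x /=.
    exact: inf_le.
  split=> [x y|t x t0].
    apply: le_infD => // _ _ [a Aa <-] [b Ab <-].
    (* In a chain, the smaller of the two functionals can serve at both [x] and [y]. *)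
    have [/lePP ab|/lePP ba] := Atot _ _ Aa Ab.
      apply: le_trans (inf_le b _ Ab) _.
      by apply: le_trans ((svalP b).1.1 x y) _; rewrite lerD2r.
    apply: le_trans (inf_le a _ Aa) _.
    by apply: le_trans ((svalP a).1.1 x y) _; rewrite lerD2l.
  rewrite -ler_pdivrMl//; apply: lb_le_inf => // _ [a Aa <-].
  rewrite ler_pdivrMl//; apply: le_trans (inf_le a _ Aa) _.
  exact: (svalP a).1.2.
exists q; split=> // r sr rq x.
have rp y : r y <= p y := le_trans (rq y) (qp y).
have /lePP qr : forall y, sval (exist P r (conj sr rp)) y
    <= sval (exist P q (conj sq qp)) y by [].
by have /(congr1 sval)/= -> := qmin _ qr.
Qed.

(* A minimal sublinear functional q equals all its shifts, so that
   q x <= q (x + z) - q z for all x and z. *)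
Lemma minimal_sublinear_scalar q : sublinear q ->
  (forall r, sublinear r -> (forall x, r x <= q x) -> forall x, r x = q x) ->
  scalar q.
Proof.
move=> sq qmin.
have qD x y : q (x + y) = q x + q y.
  apply/eqP; rewrite eq_le sq.1/=.
  have <- := qmin _ (sublinear_shift_sublinear y sq)
    (fun u => sublinear_shift_id y u sq) x.
  have := sublinear_shift_le y x sq ler01.
  by rewrite scale1r mul1r; lra.
have qN x : q (- x) = - q x.
  by apply/eqP; rewrite -addr_eq0 -qD addNr sublinear0.
move=> t x y; rewrite qD; congr (_ + _); have [t0|t0] := leP 0 t.
  exact: sublinearZ.
rewrite -{1}[t]opprK scaleNr qN sublinearZ ?oppr_ge0 ?ltW//.
by rewrite mulNr opprK.
Qed.

(* Minimizing below the shift of p by z, rather than below p itself, forces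
   f (- z) <= - p z. *)
Lemma hahn_banach p z : sublinear p ->
  exists f : V -> R, [/\ scalar f, (forall x, f x <= p x) & f z = p z].
Proof.
move=> sp; have sz := sublinear_shift_sublinear z sp.
have [f [sf fp fmin]] := sublinear_minorant_exists sz.
have fs := minimal_sublinear_scalar sf fmin.
have fp' x : f x <= p x := le_trans (fp x) (sublinear_shift_id z x sp).
exists f; split=> //; apply/eqP; rewrite eq_le fp'/=.
have := sublinear_shift_le z (- z) sp ler01.
rewrite scale1r addNr mul1r (sublinear0 sp) sub0r => pz.
have := fs (- 1) z 0; rewrite addr0 scaleN1r (sublinear0 sf) addr0 /=.
by move=> fN; have := fp (- z); rewrite fN [X in X <= _]mulN1r; lra.
Qed.

End hahn_banach.

(** * Norming functionals, diameters in the unit ball, and witnesses of norm at most one *)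

Section norming.
Context {R : realType}.

(** Hahn-Banach is applied to the norm; domination at both [x] and [- x] gives continuity and the
    bound on the dual norm. *)
Lemma norming_functional (X : normedModType R) (z : X) :
  exists2 f : dual X, unit_ball (dual X) f & f z = `|z|.
Proof.
have sn : sublinear (fun x : X => `|x|).
  split=> [x y|t x t0]; first exact: ler_normD.
  by rewrite normrZ gtr0_norm.
have [f [fs fn fz]] := hahn_banach z sn.
pose fl : {linear X -> R^o} :=
  HB.pack (f : X -> R^o) (GRing.isLinear.Build R X R^o *:%R f fs).
have fn' x : `|f x| <= `|x|.
  by rewrite ler_norml fn andbT lerNl -(normrN x) -(linearN fl) fn.
have fc : continuous (f : X -> R^o).
  apply: (@bounded_linear_continuous _ _ _ fl); apply/bounded_funP => r.
  by exists r => x xr; exact: le_trans (fn' x) xr.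
have fP : (f : X -> R^o) \in @dual_pred R X by apply/asboolP.
by exists (Dual fP) => //; apply: dual_norm_le => x /(le_trans (fn' x)).
Qed.

Lemma dualD (X : normedModType R) (f g : dual X) (x : X) :
  (f + g) x = f x + g x :> R.
Proof. by []. Qed.

Lemma dualB (X : normedModType R) (f g : dual X) (x : X) :
  (f - g) x = f x - g x :> R.
Proof. by []. Qed.

Lemma dual_le_norm (X : normedModType R) (f : dual X) (x : X) :
  unit_ball (dual X) f -> f x <= `|x| :> R.
Proof.
move=> f1; apply: le_trans (ler_norm _) _.
by apply: le_trans (dual_norm_bound f x) _; rewrite ler_piMl.
Qed.

Lemma unit_ball_dual_le_norm (X : normedModType R) (f : dual X) (x : X) :
  unit_ball X x -> f x <= `|f| :> R.
Proof. by move=> x1; apply: le_trans (ler_norm _) (dual_norm_ub f x1). Qed.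

Lemma lt_dual_norm (X : normedModType R) (f : dual X) (a : R) :
  a < `|f| -> exists2 x, unit_ball X x & a < f x.
Proof.
move=> af; have [_ [x x1 <-] ax] := sup_gt (dual_has_sup f).1 af.
move: ax; rewrite ltr_normr => /orP[ax|ax]; first by exists x.
by exists (- x); rewrite ?linearN// /unit_ball /= normrN.
Qed.

Lemma diam_unit_ball_eq2 (Y : normedModType R) (A : set Y) :
  A `<=` unit_ball Y ->
  diam A = 2%:E <->
  forall e : R, 0 < e -> exists y z, [/\ A y, A z & 2 - e < `|y - z|].
Proof.
move=> A1; split=> [dA e e0|dA].
  have : ((2 - e)%:E < diam A)%E by rewrite dA lte_fin ltrBlDr ltrDl.
  move=> /ereal_sup_gt[_ [y [z [Ay Az ->]]]]; rewrite lte_fin => yz.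
  by exists y, z.
apply/eqP; rewrite eq_le; apply/andP; split.
  apply: ge_ereal_sup => _ [y [z [/A1 y1 /A1 z1 ->]]]; rewrite lee_fin.
  by apply: le_trans (ler_normB _ _) _; rewrite [2]/(1 + 1) lerD.
apply/lee_addgt0Pr => e /dA[y [z [Ay Az yz]]].
apply: (@le_trans _ _ (`|y - z| + e)%:E).
  by rewrite lee_fin; move: yz; lra.
by rewrite EFinD leeD2r//; apply: ereal_sup_ubound; exists y, z.
Qed.

(* The witness is renormalized to unit length, which moves it by 1 - |y|. *)
Lemma uniformly_l12_point_ball (Y : completeNormedModType R) (x : Y) :
  unit_sphere Y x ->
  (forall d : R, 0 < d ->
    exists y, [/\ unit_ball Y y, 2 - d < `|x + y| & 2 - d < `|x - y|]) ->
  uniformly_l12_point x.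
Proof.
rewrite /unit_sphere /unit_ball /= => x1 xP; split=> // d d0.
(* One [d / 2] pays for the approximation, the other for the renormalization; the cap at 1 makes [y]
   nonzero. *)
pose e := Num.min (d / 2) 1.
have e0 : 0 < e by rewrite lt_min divr_gt0//=.
have [ed e1] : e <= d / 2 /\ e <= 1 by rewrite !ge_min !lexx orbT.
have [y [/= y1 xDy xBy]] := xP e e0.
have y0 : 1 - e < `|y| by have := ler_normD x y; lra.
have y0' : 0 < `|y| by lra.
pose u := `|y|^-1 *: y.
have u1 : `|u| = 1 by rewrite normrZ normfV normr_id mulVf// gt_eqF.
have uy : `|u - y| = 1 - `|y|.
  have -> : y = `|y| *: u by rewrite scalerA divff ?gt_eqF// scale1r.
  by rewrite normrZ u1 normr_id mulr1 -{1}[u]scale1r -scalerBl normrZ u1 mulr1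
     ger0_norm// subr_ge0.
exists u => //; rewrite lt_min; apply/andP; split.
  have := ler_normB (x + u) (u - y).
  by rewrite opprB addrA addrAC addrK; lra.
have := ler_normD (x - u) (u - y).
by rewrite subrKA; lra.
Qed.

End norming.

Theorem theorem4p5 (R : realType) (X : completeNormedModType R) :
  (forall x : X, unit_sphere X x ->
     (uniformly_l12_point x <->
      forall eps : R, 0 < eps -> diam (wstar_slice x eps) = 2%:E)) /\
  (forall f : dual X, unit_sphere (dual X) f ->
     (uniformly_l12_point f <->
      forall eps : R, 0 < eps -> diam (slice f eps) = 2%:E)).
Proof.
split=> [x x1|f f1]; split.
- move=> [_ xP] eps eps0; apply/diam_unit_ball_eq2 => [f []//|d d0].
  have d20 : 0 < d / 2 by rewrite divr_gt0.
  (* The bound [eps] puts [f] and [g] in the slice; [d / 2] is used twice, in [f y] and in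
     [g (- y)]. *)
  have e0 : 0 < Num.min eps (d / 2) by rewrite lt_min eps0.
  have [y y1] := xP _ e0; rewrite lt_min => /andP[].
  have [f f1 <-] := norming_functional (x + y).
  have [g g1 <-] := norming_functional (x - y).
  rewrite linearD linearB => fxy gxy.
  have [ee ed] : Num.min eps (d / 2) <= eps /\ Num.min eps (d / 2) <= d / 2.
    by rewrite !ge_min !lexx orbT.
  have fx := dual_le_norm x f1; have fy := dual_le_norm y f1.
  have gx := dual_le_norm x g1; have gNy := dual_le_norm (- y) g1.
  rewrite linearN normrN in gNy.
  rewrite /unit_sphere /= in x1 y1.
  exists f, g; split; [split=> //; lra|split=> //; lra|].
  apply: lt_le_trans (unit_ball_dual_le_norm (f - g) (_ : unit_ball X y)).
    by rewrite dualB; lra.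
  by rewrite /unit_ball /= y1.
- move=> xS; apply: uniformly_l12_point_ball => // d d0.
  have d20 : 0 < d / 2 by rewrite divr_gt0.
  have S1 : wstar_slice x (d / 2) `<=` unit_ball (dual X) by move=> f [].
  have [f [g [[f1 fx] [g1 gx]]]] := (diam_unit_ball_eq2 S1).1 (xS _ d20) _ d20.
  (* Since [f y] and [- g y] are at most 1, both exceed [1 - d / 2], so [f] and [g] show [x + y] and
     [x - y] to be long. *)
  move=> /lt_dual_norm[y y1]; rewrite dualB => fgy.
  have fxDy := dual_le_norm (x + y) f1; have gxBy := dual_le_norm (x - y) g1.
  have fy := dual_le_norm y f1; have gNy := dual_le_norm (- y) g1.
  rewrite linearD in fxDy; rewrite linearB in gxBy.
  rewrite linearN normrN in gNy; rewrite /unit_ball /= in y1.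
  by exists y; split=> //; lra.
- move=> [_ fP] eps eps0; apply/diam_unit_ball_eq2 => [x []//|d d0].
  have d20 : 0 < d / 2 by rewrite divr_gt0.
  have e0 : 0 < Num.min eps (d / 2) by rewrite lt_min eps0.
  have [g g1] := fP _ e0; rewrite lt_min => /andP[].
  (* The dual norm need not be attained, so [x] and [y] only almost norm [f + g] and [f - g]; the
     strict inequalities leave room for this. *)
  move=> /lt_dual_norm[x x1 +] /lt_dual_norm[y y1].
  rewrite dualD dualB => fgx fgy.
  have [ee ed] : Num.min eps (d / 2) <= eps /\ Num.min eps (d / 2) <= d / 2.
    by rewrite !ge_min !lexx orbT.
  rewrite /unit_sphere /= in f1 g1.
  have Ny1 : unit_ball X (- y) by rewrite /unit_ball /= normrN.
  have fx := unit_ball_dual_le_norm f x1.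
  have gx := unit_ball_dual_le_norm g x1.
  have fy := unit_ball_dual_le_norm f y1.
  have gNy := unit_ball_dual_le_norm g Ny1.
  rewrite linearN in gNy.
  exists x, y; split; [split=> //; lra|split=> //; lra|].
  have gb : unit_ball (dual X) g by rewrite /unit_ball /= g1.
  by have := dual_le_norm (x - y) gb; rewrite linearB; lra.
- move=> fS; apply: uniformly_l12_point_ball => // d d0.
  have d20 : 0 < d / 2 by rewrite divr_gt0.
  have S1 : slice f (d / 2) `<=` unit_ball X by move=> x [].
  have [x [y [[x1 fx] [y1 fy]]]] := (diam_unit_ball_eq2 S1).1 (fS _ d20) _ d20.
  (* [g] is close to 1 at [x] and to -1 at [y], while [f] is close to 1 at both. *)
  have [g g1 <-] := norming_functional (x - y); rewrite linearB => gxy.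
  have gx := dual_le_norm x g1; have gNy := dual_le_norm (- y) g1.
  rewrite linearN normrN in gNy.
  have fDg := unit_ball_dual_le_norm (f + g) x1.
  have fBg := unit_ball_dual_le_norm (f - g) y1.
  rewrite dualD in fDg; rewrite dualB in fBg.
  rewrite /unit_ball /= in x1 y1.
  by exists g; split=> //; lra.
Qed.
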